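(* The multiplication map $$(\pi'_r,\mathcal{U}'_{res})\times(\rho^*_2,\mathring{\mathcal{W}}^*_{res})\times(\pi'_l,\mathcal{U}_{res})\to(\rho_M,M),\qquad(g,F,f)\mapsto gFf,$$ is $\mathfrak{sp}(4,\mathbb{C})$-equivariant; that is, for all $X\in\mathfrak{sp}(4,\mathbb{C})$, $\rho_M(X)(gFf)=(\pi'_r(X)g)Ff+g(\rho^*_2(X)F)f+gF(\pi'_l(X)f)$.
   Context: Let $Z=\begin{pmatrix} z_{11} & z_{12} \\ z_{12} & z_{22} \end{pmatrix}$ denote a complex symmetric $2\times2$ matrix, $z_{12}=it$; use coordinates $z_{11},z_{22},t$; $N(Z)=\det Z=z_{11}z_{22}+t^2$. Let $P=\mathbb{C}[z_{11},z_{12},z_{22},N(Z)^{-1}]$ and let $N(Z)^{1/2}P$ be the corresponding space with half-integer powers of $N(Z)$ (adjoin a formal square root of $N(Z)$ to $P$; derivations extend uniquely). $\mathrm{Sym}$ is the space of complex symmetric $2\times2$ matrices, $\mathbb{S}=\mathbb{C}^2$ (columns), $\mathbb{S}'=\mathbb{C}^2$ (rows). $\partial=\begin{pmatrix} \partial_{z_{11}} & -\frac i2\partial_t \\ -\frac i2\partial_t & \partial_{z_{22}} \end{pmatrix}$. $\mathfrak{sp}(4,\mathbb{C})=\{\begin{pmatrix} A & B \\ C & -A^T \end{pmatrix}:B^T=B,\,C^T=C\}$ ($2\times2$ blocks). Below $A$, $B$, $C$ stand for $\begin{pmatrix} A & 0 \\ 0 & -A^T \end{pmatrix}$, $\begin{pmatrix}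 0 & B \\ 0 & 0 \end{pmatrix}$, $\begin{pmatrix} 0 & 0 \\ C & 0 \end{pmatrix}$. In all the modules $B$ acts by $-\mathrm{Tr}(B\partial)$. $M=N(Z)^{1/2}P$ with $\rho_M(A)f=-\mathrm{Tr}(AZ\partial+ZA^T\partial+3A)f$, $\rho_M(C)f=\mathrm{Tr}(ZCZ\partial+3CZ)f$. $\mathring{\mathcal{W}}^*_{res}=\mathrm{Sym}\otimes N(Z)^{1/2}P$ with $\rho^*_2(A)G=-\mathrm{Tr}(AZ\partial+ZA^T\partial+A)G-GA-A^TG$, $\rho^*_2(C)G=\mathrm{Tr}(ZCZ\partial+ZC)G+CZG+GZC$. $\mathcal{U}_{res}=\mathbb{S}\otimes P$ with $\pi'_l(A)f=-\mathrm{Tr}(AZ\partial+ZA^T\partial+A)f+Af$, $\pi'_l(C)f=\mathrm{Tr}(ZCZ\partial+ZC)f-ZCf$. $\mathcal{U}'_{res}=\mathbb{S}'\otimes P$ with $\pi'_r(A)g=-\mathrm{Tr}(AZ\partial+ZA^T\partial+A)g+gA^T$, $\pi'_r(C)g=\mathrm{Tr}(ZCZ\partial+CZ)g-gCZ$. *)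

(* Defs.v *)
From HB Require Import structures.
From mathcomp Require Import all_boot all_order all_algebra.
From mathcomp Require Import boolp reals.
From mathcomp Require Import complex mpoly.
From mathcomp Require Import ring.

Set Implicit Arguments.
Unset Strict Implicit.
Unset Printing Implicit Defensive.

Import GRing.Theory Num.Theory.
Local Open Scope ring_scope.
Local Open Scope quotient_scope.

Definition leibniz (A : comNzRingType) (d : A -> A) :=
  forall x y, d (x * y) = d x * y + x * d y.

Section Localization.
Variables (A : idomainType) (N : A) (N_neq0 : N != 0).

Local Notation "x %:F" := (@FracField.tofrac A x).

(* A[N^-1] as a subring of the fraction field; the proof of N != 0 is a
   parameter only so that the ring structure can be attached. *)
Definition inloc of N != 0 : {pred {fraction A}} := fun x =>
  `[< exists (p : A) (k : nat), x = p%:F / N%:F ^+ k >].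

Record loc := Loc { loc_val :> {fraction A}; _ : loc_val \in inloc N_neq0 }.

Lemma inlocP x : reflect (exists p k, x = p%:F / N%:F ^+ k) (x \in inloc N_neq0).
Proof. exact: asboolP. Qed.

Lemma inloc_subring : subring_closed (inloc N_neq0).
Proof.
have NF k : N%:F ^+ k != 0 by rewrite expf_neq0 // tofrac_eq0.
split.
- by apply/inlocP; exists 1, 0; rewrite expr0 rmorph1 divr1.
- move=> x y /inlocP[p [k ->]] /inlocP[q [l ->]]; apply/inlocP.
  exists (p * N ^+ l - q * N ^+ k), (k + l)%N.
  rewrite -mulNr addf_div // mulNr exprD; congr (_ / _).
  by rewrite -!rmorphXn -!rmorphM -rmorphB.
- move=> x y /inlocP[p [k ->]] /inlocP[q [l ->]]; apply/inlocP.
  by exists (p * q), (k + l)%N; rewrite rmorphM exprD mulf_div.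
Qed.

(* The derivative of x = n / d, by the quotient rule. *)
Definition fderiv (d : A -> A) (x : {fraction A}) : {fraction A} :=
  let r := repr x in
  (d (\n_r) * \d_r - \n_r * d (\d_r))%:F / (\d_r)%:F ^+ 2.

Lemma reprE (x : {fraction A}) : x = (\n_(repr x))%:F / (\d_(repr x))%:F.
Proof.
have d0 : (\d_(repr x))%:F != 0.
  by rewrite tofrac_eq0 denom_ratioP.
apply: (mulIf d0); rewrite divfK // -{1}[x]reprK.
move: (repr x) (denom_ratioP (repr x)) {d0} => r r0.
rewrite {1}/GRing.mul /=; unlock FracField.tofrac.
rewrite -[LHS]FracField.pi_mul; apply/eqmodP; rewrite /= FracField.equivfE.
rewrite /FracField.mulf !numden_Ratio ?mulr1 ?oner_eq0 //.
by rewrite mulrC.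
Qed.

Lemma fderivE d (p q : A) : leibniz d -> q != 0 ->
  fderiv d (p%:F / q%:F) = (d p * q - p * d q)%:F / q%:F ^+ 2.
Proof.
move=> dM q0; rewrite /fderiv; have := reprE (p%:F / q%:F).
move: (repr _) => r; have := denom_ratioP r.
move: (\n_r) (\d_r) => n m m0 {r}.
have mF : m%:F != 0 by rewrite tofrac_eq0.
have qF : q%:F != 0 by rewrite tofrac_eq0.
move/eqP;  rewrite eqr_div // -!rmorphM tofrac_eq => /eqP e.
have e' := congr1 d e; rewrite !dM in e'.
apply/eqP; rewrite eqr_div ?expf_neq0 // -!rmorphXn -!rmorphM tofrac_eq.
apply/eqP.
have h1 : d p * m = d n * q + n * d q - p * d m by rewrite -e'; ring.
have -> : (d p * q - p * d q) * m ^+ 2 =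
  (d p * m) * (q * m) - (p * m) * d q * m by ring.
rewrite h1 e.
have -> : (d n * q + n * d q - p * d m) * (q * m) - n * q * d q * m =
  d n * q ^+ 2 * m - (p * m) * d m * q by ring.
by rewrite e; ring.
Qed.

HB.instance Definition _ :=
  GRing.isSubringClosed.Build {fraction A} (inloc N_neq0) inloc_subring.
HB.instance Definition _ := [isSub for loc_val].
HB.instance Definition _ := [Choice of loc by <:].
HB.instance Definition _ := [SubChoice_isSubComNzRing of loc by <:].

Lemma tofrac_inloc p : p%:F \in inloc N_neq0.
Proof. by apply/inlocP; exists p, 0; rewrite expr0 divr1. Qed.

Definition toloc (p : A) : loc := Loc (tofrac_inloc p).

Lemma toloc_zmod_morphism : zmod_morphism toloc.
Proof. by move=> p q; apply: val_inj; rewrite /= rmorphB. Qed.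

Lemma toloc_monoid_morphism : monoid_morphism toloc.
Proof.
by split=> [|p q]; apply: val_inj; rewrite /= ?rmorph1 // rmorphM.
Qed.

HB.instance Definition _ :=
  GRing.isZmodMorphism.Build A loc toloc toloc_zmod_morphism.
HB.instance Definition _ :=
  GRing.isMonoidMorphism.Build A loc toloc toloc_monoid_morphism.

Lemma invN_inloc : N%:F^-1 \in inloc N_neq0.
Proof. by apply/inlocP; exists 1, 1; rewrite rmorph1 expr1 div1r. Qed.

Definition locinv : loc := Loc invN_inloc.

Lemma locinvK : locinv * toloc N = 1.
Proof. by apply: val_inj; rewrite /= mulVf // tofrac_eq0. Qed.

Variables (d : A -> A) (dM : leibniz d).

Lemma fderiv_inloc (x : loc) : fderiv d x \in inloc N_neq0.
Proof.
case: x => x /= /inlocP[p [k ->]]; apply/inlocP.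
rewrite -rmorphXn fderivE ?expf_neq0 // rmorphXn -exprM.
by eexists; exists (k * 2)%N.
Qed.

Definition locderiv (x : loc) : loc := Loc (fderiv_inloc x).

Lemma locderiv_toloc p : locderiv (toloc p) = toloc (d p).
Proof.
apply: val_inj => /=.
have d1 : d 1 = 0.
  by apply: (addIr (d 1)); rewrite add0r -[in RHS](mulr1 1) dM mulr1 mul1r.
rewrite -[p%:F]divr1 -(rmorph1 (@FracField.tofrac A)) fderivE ?oner_eq0 //.
by rewrite d1 mulr0 subr0 mulr1 rmorph1 expr1n divr1.
Qed.

Lemma locderivM : leibniz locderiv.
Proof.
move=> [x xP] [y yP]; apply: val_inj => /=.
move: xP yP => /inlocP[p [k ->]] /inlocP[q [l ->]].
have N0 n : N ^+ n != 0 by rewrite expf_neq0.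
rewrite -!rmorphXn mulf_div -!rmorphM !fderivE // ?mulf_neq0 //.
rewrite !mulf_div addf_div ?mulf_neq0 ?expf_neq0 ?tofrac_eq0 //.
rewrite -?rmorphXn -?rmorphM -?rmorphXn -?rmorphM -rmorphD.
apply/eqP; rewrite eqr_div ?tofrac_eq0 ?mulf_neq0 ?expf_neq0 // -!rmorphM.
rewrite tofrac_eq !dM; apply/eqP.
by move: (N ^+ k) (N ^+ l) => a b; ring.
Qed.

Lemma locderivD : {morph d : p q / p + q} -> {morph locderiv : x y / x + y}.
Proof.
move=> dD [x xP] [y yP]; apply: val_inj => /=.
move: xP yP => /inlocP[p [k ->]] /inlocP[q [l ->]].
have N0 n : N ^+ n != 0 by rewrite expf_neq0.
rewrite -!rmorphXn addf_div ?tofrac_eq0 // -!rmorphM -rmorphD.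
rewrite !fderivE // ?mulf_neq0 //.
rewrite addf_div ?mulf_neq0 ?expf_neq0 ?tofrac_eq0 //.
rewrite -?rmorphXn -?rmorphM -?rmorphXn -?rmorphM -rmorphD.
apply/eqP; rewrite eqr_div ?tofrac_eq0 ?mulf_neq0 ?expf_neq0 // -!rmorphM.
rewrite tofrac_eq !(dM, dD); apply/eqP.
by move: (N ^+ k) (N ^+ l) => a b; ring.
Qed.

End Localization.

Section SquareRoot.
Variables (A : comNzRingType) (u : A).

(* A[s] / (s ^ 2 - u): x has coordinates x`_0 + x`_1 s. *)
Definition adjsqrt : comNzRingType := {poly %/ 'X^2 - u%:P}.

Definition ofbase (a : A) : adjsqrt := qpolyC ('X^2 - u%:P) a.
Lemma ofbase_zmod_morphism : zmod_morphism ofbase.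
Proof. exact: qpolyC_is_zmod_morphism. Qed.

Lemma ofbase_monoid_morphism : monoid_morphism ofbase.
Proof. exact: qpolyC_is_monoid_morphism. Qed.

HB.instance Definition _ :=
  GRing.isZmodMorphism.Build A adjsqrt ofbase ofbase_zmod_morphism.
HB.instance Definition _ :=
  GRing.isMonoidMorphism.Build A adjsqrt ofbase ofbase_monoid_morphism.

Definition sqrtu : adjsqrt := qpolyX ('X^2 - u%:P).

Definition adjpoly (x : adjsqrt) : {poly A} := (x : {poly %/ 'X^2 - u%:P}).
Definition coord0 (x : adjsqrt) : A := (adjpoly x)`_0.
Definition coord1 (x : adjsqrt) : A := (adjpoly x)`_1.

Let mod_monicE : mk_monic ('X^2 - u%:P) = 'X^2 - u%:P.
Proof. by rewrite /mk_monic size_XnsubC // monicXnsubC. Qed.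

Lemma ofbaseE a : ofbase a = in_qpoly ('X^2 - u%:P) a%:P.
Proof.
apply: val_inj; apply/esym/in_qpoly_small.
by rewrite mod_monicE size_XnsubC // size_polyC; case: eqP.
Qed.

Lemma adjpoly_coords a b :
  adjpoly (ofbase a + ofbase b * sqrtu) = a%:P + b%:P * 'X.
Proof.
have -> : ofbase a + ofbase b * sqrtu =
          in_qpoly ('X^2 - u%:P) (a%:P + b%:P * 'X).
  by rewrite rmorphD rmorphM !ofbaseE.
rewrite /adjpoly in_qpoly_small // mod_monicE size_XnsubC // addrC.
by rewrite size_MXaddC; case: ifP => // _; rewrite ltnS ltnS size_polyC leq_b1.
Qed.

Lemma coord0E a b : coord0 (ofbase a + ofbase b * sqrtu) = a.
Proof. by rewrite /coord0 adjpoly_coords coefD coefC coefMX addr0. Qed.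

Lemma coord1E a b : coord1 (ofbase a + ofbase b * sqrtu) = b.
Proof. by rewrite /coord1 adjpoly_coords coefD coefC coefMX coefC add0r. Qed.

Lemma size_adjpoly x : (size (adjpoly x) <= 2)%N.
Proof.
have : (size (adjpoly x) < size (mk_monic ('X^2 - u%:P)))%N.
  exact: size_mk_monic.
by rewrite mod_monicE size_XnsubC.
Qed.

Lemma coordE x : x = ofbase (coord0 x) + ofbase (coord1 x) * sqrtu.
Proof.
have adjpoly_inj : injective adjpoly by apply: val_inj.
apply: adjpoly_inj; rewrite adjpoly_coords; apply/polyP => i.
rewrite coefD coefC coefCM coefX.
case: i => [|[|i]] /=; rewrite ?mulr0 ?mulr1 ?addr0 ?add0r //.
by rewrite nth_default // (leq_trans (size_adjpoly x)).
Qed.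

Lemma sqrtuK : sqrtu * sqrtu = ofbase u.
Proof.
apply/eqP; rewrite -subr_eq0 ofbaseE /sqrtu /qpolyX -rmorphM -rmorphB -expr2.
apply/eqP; apply: val_inj.
by rewrite /= mod_monicE Pdiv.RingMonic.rmodpp // monicXnsubC.
Qed.

(* The extension of d with d s = w s; s ^ 2 = u forces 2 u w = d u. *)
Definition adjderiv (d : A -> A) (w : A) (x : adjsqrt) : adjsqrt :=
  ofbase (d (coord0 x)) + ofbase (d (coord1 x) + coord1 x * w) * sqrtu.

Lemma adjderivD d w : {morph d : x y / x + y} ->
  {morph adjderiv d w : x y / x + y}.
Proof.
move=> dD x y; rewrite /adjderiv.
have -> : coord0 (x + y) = coord0 x + coord0 y by rewrite /coord0 coefD.
have -> : coord1 (x + y) = coord1 x + coord1 y by rewrite /coord1 coefD.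
rewrite !dD !(rmorphD, rmorphM) /=; ring.
Qed.

Lemma adjderivM d w : {morph d : x y / x + y} -> leibniz d ->
  2%:R * u * w = d u -> leibniz (adjderiv d w).
Proof.
move=> dD dM hw x y.
rewrite (coordE x) (coordE y).
set a := coord0 x; set b := coord1 x; set a' := coord0 y; set b' := coord1 y.
have -> : (ofbase a + ofbase b * sqrtu) * (ofbase a' + ofbase b' * sqrtu) =
  ofbase (a * a' + b * b' * u) + ofbase (a * b' + b * a') * sqrtu.
  rewrite !(rmorphD, rmorphM) /= -sqrtuK; ring.
rewrite /adjderiv !coord0E !coord1E !(dD, dM) -hw.
rewrite !(rmorphD, rmorphM) /= -sqrtuK ?rmorph1; ring.
Qed.

Lemma adjderiv_ofbase d w a : d 0 = 0 -> adjderiv d w (ofbase a) = ofbase (d a).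
Proof.
move=> d0; rewrite -[ofbase a]addr0 -[X in _ + X](mul0r sqrtu) -(rmorph0 ofbase).
by rewrite /adjderiv coord0E coord1E d0 mul0r addr0 rmorph0 mul0r addr0.
Qed.

(* u^(1/2) A = s A; for u invertible it contains every u^(k + 1/2), k in Z. *)
Definition inhalf : {pred adjsqrt} := fun x =>
  `[< exists a : A, x = ofbase a * sqrtu >].

Lemma inhalfP x : reflect (exists a, x = ofbase a * sqrtu) (x \in inhalf).
Proof. exact: asboolP. Qed.

Lemma inhalf_zmod : zmod_closed inhalf.
Proof.
split=> [|x y /inhalfP[a ->] /inhalfP[b ->]]; apply/inhalfP.
  by exists 0; rewrite rmorph0 mul0r.
by exists (a - b); rewrite rmorphB mulrBl.
Qed.

HB.instance Definition _ :=
  GRing.isZmodClosed.Build adjsqrt inhalf inhalf_zmod.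

Record half := Half { half_val :> adjsqrt; _ : half_val \in inhalf }.
HB.instance Definition _ := [isSub for half_val].
HB.instance Definition _ := [Choice of half by <:].
HB.instance Definition _ := [SubChoice_isSubZmodule of half by <:].

Lemma inhalfM a x : x \in inhalf -> ofbase a * x \in inhalf.
Proof.
by case/inhalfP=> b ->; apply/inhalfP; exists (a * b); rewrite rmorphM mulrA.
Qed.

Lemma inhalf_deriv d w x : d 0 = 0 -> x \in inhalf ->
  adjderiv d w x \in inhalf.
Proof.
move=> d0 /inhalfP[b ->]; apply/inhalfP; exists (d b + b * w).
rewrite -[X in adjderiv d w X]add0r -(rmorph0 ofbase).
by rewrite /adjderiv coord0E coord1E d0 rmorph0 add0r.
Qed.

End SquareRoot.
Section Sp4.
Variable K : nzRingType.

Definition is_sp4 (X : 'M[K]_(2 + 2)) :=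
  [&& (ursubmx X)^T == ursubmx X, (dlsubmx X)^T == dlsubmx X
    & drsubmx X == - (ulsubmx X)^T].

Record sp4 := Sp4 { sp4_val : 'M[K]_(2 + 2); _ : is_sp4 sp4_val }.

Definition spA (X : sp4) : 'M[K]_2 := ulsubmx (sp4_val X).
Definition spB (X : sp4) : 'M[K]_2 := ursubmx (sp4_val X).
Definition spC (X : sp4) : 'M[K]_2 := dlsubmx (sp4_val X).

Lemma spC_sym X : (spC X)^T = spC X.
Proof. by case: X => X h; have /and3P[_ /eqP] := h. Qed.

Lemma spB_sym X : (spB X)^T = spB X.
Proof. by case: X => X h; have /and3P[/eqP] := h. Qed.

End Sp4.

Definition c11 : 'I_3 := @Ordinal 3 0 isT.
Definition c22 : 'I_3 := @Ordinal 3 1 isT.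
Definition ct : 'I_3 := @Ordinal 3 2 isT.

(* Used below with Q = P = C[z11, z12, z22, N^-1] and with Q = P[sqrt N];
   pd i is the partial derivative in z11, z22, t for i = c11, c22, ct. *)
Section Operators.
Variables (R : rcfType) (Q : comNzRingType) (cst : R[i] -> Q).
Variables (pd : 'I_3 -> Q -> Q) (Z : 'M[Q]_2).

(* The entries of the matrix d; off the diagonal, -(i/2) d_t. *)
Definition dZ (i j : 'I_2) (x : Q) : Q :=
  if i == j then (if i == 0 then pd c11 x else pd c22 x)
  else cst (- 'i%C / 2%:R) * pd ct x.

(* Tr(T d), with the coefficients to the left of the derivations. *)
Definition TrD (T : 'M[Q]_2) (x : Q) : Q := \sum_i \sum_j T i j * dZ j i x.
Definition TrDmx m n (T : 'M[Q]_2) (f : 'M[Q]_(m, n)) : 'M[Q]_(m, n) :=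
  map_mx (TrD T) f.

Local Notation "A ^q" := (map_mx cst A) (at level 1, format "A ^q").
Implicit Types A B C : 'M[R[i]]_2.

Definition rhoM_A A (f : Q) : Q :=
  - (TrD (A^q *m Z + Z *m A^q^T) f + \tr (3%:R *: A^q) * f).
Definition rhoM_B B (f : Q) : Q := - TrD B^q f.
Definition rhoM_C C (f : Q) : Q :=
  TrD (Z *m C^q *m Z) f + \tr (3%:R *: (C^q *m Z)) * f.

Definition rho2_A A (G : 'M[Q]_2) : 'M[Q]_2 :=
  - (TrDmx (A^q *m Z + Z *m A^q^T) G + \tr A^q *: G)
  - G *m A^q - A^q^T *m G.
Definition rho2_B B (G : 'M[Q]_2) : 'M[Q]_2 := - TrDmx B^q G.
Definition rho2_C C (G : 'M[Q]_2) : 'M[Q]_2 :=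
  TrDmx (Z *m C^q *m Z) G + \tr (Z *m C^q) *: G
  + C^q *m Z *m G + G *m Z *m C^q.

Definition pil_A A (f : 'cV[Q]_2) : 'cV[Q]_2 :=
  - (TrDmx (A^q *m Z + Z *m A^q^T) f + \tr A^q *: f) + A^q *m f.
Definition pil_B B (f : 'cV[Q]_2) : 'cV[Q]_2 := - TrDmx B^q f.
Definition pil_C C (f : 'cV[Q]_2) : 'cV[Q]_2 :=
  TrDmx (Z *m C^q *m Z) f + \tr (Z *m C^q) *: f - Z *m C^q *m f.

Definition pir_A A (g : 'rV[Q]_2) : 'rV[Q]_2 :=
  - (TrDmx (A^q *m Z + Z *m A^q^T) g + \tr A^q *: g) + g *m A^q^T.
Definition pir_B B (g : 'rV[Q]_2) : 'rV[Q]_2 := - TrDmx B^q g.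
Definition pir_C C (g : 'rV[Q]_2) : 'rV[Q]_2 :=
  TrDmx (Z *m C^q *m Z) g + \tr (C^q *m Z) *: g - g *m C^q *m Z.

Lemma TrDmx_tr m n (T : 'M[Q]_2) (G : 'M[Q]_(m, n)) :
  (TrDmx T G)^T = TrDmx T G^T.
Proof. exact: map_trmx. Qed.

Lemma trmxD (G H : 'M[Q]_2) : (G + H)^T = G^T + H^T.
Proof. by apply/matrixP => i j; rewrite !mxE. Qed.

Lemma trmxN (G : 'M[Q]_2) : (- G)^T = - G^T.
Proof. by apply/matrixP => i j; rewrite !mxE. Qed.

Lemma trmxZ a (G : 'M[Q]_2) : (a *: G)^T = a *: G^T.
Proof. by apply/matrixP => i j; rewrite !mxE. Qed.

Lemma rho2_A_sym A G : Z^T = Z -> G^T = G -> (rho2_A A G)^T = rho2_A A G.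
Proof.
move=> sZ sG; rewrite /rho2_A; move: (map_mx cst A) => a.
rewrite !(trmxD, trmxN, trmxZ) TrDmx_tr sG !trmx_mul trmxK sG.
by rewrite addrAC.
Qed.

Lemma rho2_B_sym B G : G^T = G -> (rho2_B B G)^T = rho2_B B G.
Proof. by move=> sG; rewrite /rho2_B linearN /= TrDmx_tr sG. Qed.

Lemma rho2_C_sym C G :
  C^T = C -> Z^T = Z -> G^T = G -> (rho2_C C G)^T = rho2_C C G.
Proof.
move=> sC sZ sG; rewrite /rho2_C.
have : (map_mx cst C)^T = map_mx cst C by rewrite map_trmx sC.
move: (map_mx cst C) => c sc.
rewrite !(trmxD, trmxZ) TrDmx_tr sG !trmx_mul sZ sG sc.
by rewrite addrAC !mulmxA.
Qed.

End Operators.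

Section Modules.
Variable R : realType.

(* C[z11, z12, z22] in the coordinates z11, z22, t, where z12 = i t. *)
Definition polZ : idomainType := {mpoly R[i][3]}.

Definition Zpol : 'M[polZ]_2 := \matrix_(i, j)
  if i == j then (if i == 0 then 'X_c11 else 'X_c22) else 'i%C *: 'X_ct.

Definition Npol : polZ := \det Zpol.

Lemma NpolE : Npol = 'X_c11 * 'X_c22 + 'X_ct ^+ 2.
Proof.
rewrite /Npol (expand_det_row _ ord0) !big_ord_recl big_ord0 /cofactor.
rewrite !det_mx11 !mxE /= addr0 expr0 expr1 mul1r mulN1r mulrN.
have -> : 'i%C *: 'X_ct * ('i%C *: 'X_ct) =
          - ('X_ct * 'X_ct) :> {mpoly R[i][3]}.
  rewrite -scalerAl -scalerAr scalerA.
  have -> : 'i%C * 'i%C = -1 :> R[i] by rewrite -expr2 sqr_i.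
  by rewrite scaleN1r.
by rewrite opprK expr2.
Qed.

Lemma Npol_neq0 : Npol != 0.
Proof.
have h : mcoeff (U_(ct) *+ 2)%MM
    ('X_c11 * 'X_c22 + 'X_ct ^+ 2 : {mpoly R[i][3]}) = 1.
  rewrite mcoeffD -mpolyXD mpolyXn !mcoeffX eqxx.
  by case: eqP => [/mnmP/(_ c11)|_]; rewrite ?add0r // !(mnmDE, mulmnE, mnm1E).
apply/eqP; rewrite NpolE => e; move: h; rewrite e mcoeff0 => /eqP.
by rewrite eq_sym oner_eq0.
Qed.

Lemma mderiv_leibniz i : leibniz (mderiv i : polZ -> polZ).
Proof. by move=> p q; apply: mderivM. Qed.

(* P = C[z11, z12, z22, N^-1]. *)
Definition Pring : comNzRingType := loc Npol_neq0.
Definition polP : polZ -> Pring := toloc Npol_neq0.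
Definition NP : Pring := polP Npol.
Definition cstP (c : R[i]) : Pring := polP c%:MP.
Definition pdP (i : 'I_3) : Pring -> Pring := locderiv (mderiv_leibniz i).
Definition ZP : 'M[Pring]_2 := map_mx polP Zpol.

(* P[s] / (s ^ 2 - N). *)
Definition Psqrt : comNzRingType := adjsqrt NP.
Definition embP : Pring -> Psqrt := ofbase NP.
HB.instance Definition _ := GRing.RMorphism.copy embP (ofbase NP).
Definition cstS (c : R[i]) : Psqrt := embP (cstP c).
(* d s = d N / (2 N) s. *)
Definition pdS (i : 'I_3) : Psqrt -> Psqrt :=
  adjderiv (pdP i) (cstP 2%:R^-1 * locinv Npol_neq0 * pdP i NP).
Definition ZS : 'M[Psqrt]_2 := map_mx embP ZP.

Lemma pdP_leibniz i : leibniz (pdP i).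
Proof. exact: locderivM. Qed.

Lemma pdPD i : {morph pdP i : x y / x + y}.
Proof. by apply: locderivD => p q; apply: mderivD. Qed.

Lemma pdP0 i : pdP i 0 = 0.
Proof. by apply: (addIr (pdP i 0)); rewrite -pdPD !add0r. Qed.

Lemma pdP_polP i p : pdP i (polP p) = polP (mderiv i p).
Proof. exact: locderiv_toloc. Qed.

Lemma pdS_leibniz i : leibniz (pdS i).
Proof.
apply: adjderivM; [exact: pdPD | exact: pdP_leibniz |].
have h : 2%:R * cstP 2%:R^-1 = 1.
  rewrite -(rmorph_nat (toloc Npol_neq0)) -rmorphM.
  rewrite -[RHS](rmorph1 (toloc Npol_neq0)).
  congr (toloc _ _); rewrite -(rmorph_nat (@mpolyC 3 R[i])) -mpolyCM divff //.
  by rewrite pnatr_eq0.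
have k : locinv Npol_neq0 * NP = 1 by apply: locinvK.
transitivity ((2%:R * cstP 2%:R^-1) * (locinv Npol_neq0 * NP) * pdP i NP).
  by ring.
by rewrite h k !mul1r.
Qed.

Lemma pdSD i : {morph pdS i : x y / x + y}.
Proof. by apply: adjderivD; apply: pdPD. Qed.

Lemma pdS_embP i x : pdS i (embP x) = embP (pdP i x).
Proof. by apply: adjderiv_ofbase; apply: pdP0. Qed.

Definition modU : Type := 'cV[Pring]_2.
Definition modU' : Type := 'rV[Pring]_2.

(* N^(1/2) P = s P. *)
Definition modM : zmodType := half NP.

(* Sym (x) N^(1/2) P: symmetric matrices with entries in N^(1/2) P. *)
Definition inW (G : 'M[Psqrt]_2) :=
  (G^T == G) && [forall i, forall j, G i j \in @inhalf Pring NP].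
Record modW := ModW { modW_val : 'M[Psqrt]_2; _ : inW modW_val }.

Lemma dZ_half i j (x : Psqrt) :
  x \in @inhalf Pring NP -> dZ cstS pdS i j x \in @inhalf Pring NP.
Proof.
move=> hx; rewrite /dZ; do 2?case: ifP => _;
  try exact: inhalf_deriv (pdP0 _) hx.
by apply: inhalfM; apply: inhalf_deriv (pdP0 _) hx.
Qed.

Lemma TrD_half (T : 'M[Pring]_2) (x : Psqrt) : x \in @inhalf Pring NP ->
  TrD cstS pdS (map_mx embP T) x \in @inhalf Pring NP.
Proof.
move=> hx; apply: rpred_sum => i _; apply: rpred_sum => j _.
by rewrite mxE; apply/inhalfM/dZ_half.
Qed.

Definition mxhalf m n (G : 'M[Psqrt]_(m, n)) :=
  forall i j, G i j \in @inhalf Pring NP.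

Lemma mxhalfD m n (G H : 'M[Psqrt]_(m, n)) :
  mxhalf G -> mxhalf H -> mxhalf (G + H).
Proof. by move=> hG hH i j; rewrite mxE rpredD. Qed.

Lemma mxhalfN m n (G : 'M[Psqrt]_(m, n)) : mxhalf G -> mxhalf (- G).
Proof. by move=> hG i j; rewrite mxE rpredN. Qed.

Lemma mxhalfMl m n p (T : 'M[Pring]_(m, n)) (G : 'M[Psqrt]_(n, p)) :
  mxhalf G -> mxhalf (map_mx embP T *m G).
Proof.
move=> hG i j; rewrite mxE; apply: rpred_sum => k _.
by rewrite mxE; apply: inhalfM.
Qed.

Lemma mxhalfMr m n p (T : 'M[Pring]_(n, p)) (G : 'M[Psqrt]_(m, n)) :
  mxhalf G -> mxhalf (G *m map_mx embP T).
Proof.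
move=> hG i j; rewrite mxE; apply: rpred_sum => k _.
by rewrite mxE mulrC; apply: inhalfM.
Qed.

Lemma mxhalfZ m n a (G : 'M[Psqrt]_(m, n)) : mxhalf G -> mxhalf (embP a *: G).
Proof. by move=> hG i j; rewrite mxE; apply: inhalfM. Qed.

Lemma mxhalf_TrD m n (T : 'M[Pring]_2) (G : 'M[Psqrt]_(m, n)) : mxhalf G ->
  mxhalf (TrDmx cstS pdS (map_mx embP T) G).
Proof. by move=> hG i j; rewrite mxE; apply: TrD_half. Qed.

Lemma cstS_mx (A : 'M[R[i]]_2) : map_mx cstS A = map_mx embP (map_mx cstP A).
Proof. by apply/matrixP => i j; rewrite !mxE. Qed.

Lemma ZS_sym : ZS^T = ZS.
Proof.
by apply/matrixP => i j; rewrite !mxE eq_sym; case: eqP => [->|_].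
Qed.

Lemma inWP G : reflect (G^T = G /\ mxhalf G) (inW G).
Proof.
apply: (iffP andP) => -[/eqP h1 h2]; split; rewrite ?h1 ?eqxx //.
  by move=> i j; move/forallP/(_ i)/forallP: h2; apply.
by apply/forallP => i; apply/forallP => j.
Qed.

Definition rhoMS (X : sp4 R[i]) (f : Psqrt) : Psqrt :=
  rhoM_A cstS pdS ZS (spA X) f + rhoM_B cstS pdS (spB X) f
  + rhoM_C cstS pdS ZS (spC X) f.

Lemma rhoMS_half X (f : modM) : rhoMS X (half_val f) \in @inhalf Pring NP.
Proof.
case: f => f hf /=; rewrite /rhoMS /rhoM_A /rhoM_B /rhoM_C /ZS !cstS_mx.
rewrite map_trmx -!map_mxM -(map_mxD embP) -[3%:R](rmorph_nat embP).
rewrite -!map_mxZ !trace_map_mx.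
by rewrite !(rpredD, rpredN) ?TrD_half ?inhalfM.
Qed.

Definition rhoM (X : sp4 R[i]) (f : modM) : modM := Half (rhoMS_half X f).

Definition rho2S (X : sp4 R[i]) (G : 'M[Psqrt]_2) : 'M[Psqrt]_2 :=
  rho2_A cstS pdS ZS (spA X) G + rho2_B cstS pdS (spB X) G
  + rho2_C cstS pdS ZS (spC X) G.

Lemma rho2S_inW X (G : modW) : inW (rho2S X (modW_val G)).
Proof.
case: G => G /= /inWP[sG hG]; apply/inWP; split.
  rewrite /rho2S 2!trmxD rho2_A_sym ?rho2_B_sym ?rho2_C_sym ?ZS_sym //.
  exact: spC_sym.
rewrite /rho2S /rho2_A /rho2_B /rho2_C /ZS !cstS_mx.
rewrite map_trmx -!map_mxM -(map_mxD embP) !trace_map_mx.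
apply: mxhalfD; [apply: mxhalfD|].
- apply: mxhalfD; first apply: mxhalfD; apply: mxhalfN.
  + by apply: mxhalfD; [apply: mxhalf_TrD | apply: mxhalfZ].
  + exact: mxhalfMr.
  + exact: mxhalfMl.
- by apply: mxhalfN; apply: mxhalf_TrD.
- apply: mxhalfD; first apply: mxhalfD.
  + by apply: mxhalfD; [apply: mxhalf_TrD | apply: mxhalfZ].
  + exact: mxhalfMl.
  + by apply: mxhalfMr; apply: mxhalfMr.
Qed.

Definition rho2 (X : sp4 R[i]) (G : modW) : modW := ModW (rho2S_inW X G).

Definition pil (X : sp4 R[i]) (f : modU) : modU :=
  pil_A cstP pdP ZP (spA X) f + pil_B cstP pdP (spB X) f
  + pil_C cstP pdP ZP (spC X) f.

Definition pir (X : sp4 R[i]) (g : modU') : modU' :=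
  pir_A cstP pdP ZP (spA X) g + pir_B cstP pdP (spB X) g
  + pir_C cstP pdP ZP (spC X) g.

Lemma mul3_half (g : modU') (F : modW) (f : modU) :
  (map_mx embP g *m modW_val F *m map_mx embP f) 0 0 \in @inhalf Pring NP.
Proof. by case: F => F /= /inWP[_ hF]; apply/mxhalfMr/mxhalfMl. Qed.

(* (g, F, f) |-> g F f, the entry of a 1 x 1 matrix over P[sqrt N]. *)
Definition mul3 (g : modU') (F : modW) (f : modU) : modM :=
  Half (mul3_half g F f).

End Modules.

(* Main.v *)
Require Import Defs.
From mathcomp Require Import all_boot all_order all_algebra.
From mathcomp Require Import reals complex mpoly.
From mathcomp Require Import ring.
Import GRing.Theory.
Local Open Scope ring_scope.

(** The first-order parts of all four actions are the same derivation, hence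
satisfy the Leibniz rule on [gFf]; the traces of the three factors add up to
that of [M], and the remaining matrix terms cancel inside [gFf]. *)

Section Derivations.
Variables (R : rcfType) (Q : comNzRingType) (cst : R[i] -> Q).
Variables (pd : 'I_3 -> Q -> Q) (Z : 'M[Q]_2).
Hypothesis pdD : forall i, {morph pd i : x y / x + y}.
Hypothesis pdM : forall i, leibniz (pd i).

Lemma dZD i j : {morph dZ cst pd i j : x y / x + y}.
Proof. by move=> x y; rewrite /dZ; do 2?case: ifP => _; rewrite pdD ?mulrDr. Qed.

Lemma dZ_leibniz i j : leibniz (dZ cst pd i j).
Proof.
by move=> x y; rewrite /dZ; do 2?case: ifP => _; rewrite pdM //; ring.
Qed.

Lemma TrDD T : {morph TrD cst pd T : x y / x + y}.
Proof.
move=> x y; rewrite /TrD -big_split; apply: eq_bigr => i _.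
by rewrite -big_split; apply: eq_bigr => j _; rewrite dZD mulrDr.
Qed.

(** Since [Q] is commutative, a combination of derivations with coefficients on the left is again a
    derivation. *)
Lemma TrD_leibniz T : leibniz (TrD cst pd T).
Proof.
move=> x y; rewrite /TrD mulr_suml mulr_sumr -big_split; apply: eq_bigr => i _.
rewrite mulr_suml mulr_sumr -big_split; apply: eq_bigr => j _ /=.
by rewrite dZ_leibniz; ring.
Qed.

Lemma TrD_sum T n (F : 'I_n -> Q) :
  TrD cst pd T (\sum_i F i) = \sum_i TrD cst pd T (F i).
Proof.
apply: (big_morph _ (TrDD T)).
by apply: (addIr (TrD cst pd T 0)); rewrite -TrDD !add0r.
Qed.

Lemma TrDmxM T m n p (G : 'M[Q]_(m, n)) (H : 'M[Q]_(n, p)) :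
  TrDmx cst pd T (G *m H) = TrDmx cst pd T G *m H + G *m TrDmx cst pd T H.
Proof.
apply/matrixP => i j; rewrite !mxE TrD_sum -big_split; apply: eq_bigr => k _.
by rewrite TrD_leibniz !mxE.
Qed.

(** These special cases of [mxE] open sums, signs and scalings of 1 x 1 matrices but leave products
    folded, so that [ring] treats each entry of a triple product as an atom. *)
Let mxDE (G H : 'M[Q]_1) i j : (G + H) i j = G i j + H i j.
Proof. by rewrite mxE. Qed.
Let mxNE (G : 'M[Q]_1) i j : (- G) i j = - G i j.
Proof. by rewrite mxE. Qed.
Let mxZE a (G : 'M[Q]_1) i j : (a *: G) i j = a * G i j.
Proof. by rewrite mxE. Qed.

Variables (g : 'rV[Q]_2) (F : 'M[Q]_2) (f : 'cV[Q]_2).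

Lemma TrD_mul3 T :
  TrD cst pd T ((g *m F *m f) 0 0) =
    (TrDmx cst pd T g *m F *m f + g *m TrDmx cst pd T F *m f
     + g *m F *m TrDmx cst pd T f) 0 0.
Proof.
by rewrite -mulmxDl -!TrDmxM [RHS]mxE.
Qed.

(** Each factor contributes one tr A, which gives the 3 of [rhoM_A]. The term g A^T F f comes from
    [pir_A] with sign + and from [rho2_A] with sign -; so does g F A f from [pil_A] and [rho2_A]. *)
Lemma rhoM_A_mul3 A :
  rhoM_A cst pd Z A ((g *m F *m f) 0 0) =
    (pir_A cst pd Z A g *m F *m f + g *m rho2_A cst pd Z A F *m f
     + g *m F *m pil_A cst pd Z A f) 0 0.
Proof.
rewrite /rhoM_A /pir_A /rho2_A /pil_A TrD_mul3 mxtraceZ.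
(* Reassociating to the left makes the cancelling products syntactically equal. *)
rewrite !(mulmxDl, mulmxDr, mulNmx, mulmxN) -!(scalemxAl, scalemxAr) !mulmxA.
rewrite !(mxDE, mxNE, mxZE); ring.
Qed.

Lemma rhoM_B_mul3 B :
  rhoM_B cst pd B ((g *m F *m f) 0 0) =
    (pir_B cst pd B g *m F *m f + g *m rho2_B cst pd B F *m f
     + g *m F *m pil_B cst pd B f) 0 0.
Proof.
rewrite /rhoM_B /pir_B /rho2_B /pil_B TrD_mul3.
rewrite !(mulNmx, mulmxN) !(mxDE, mxNE); ring.
Qed.

(** As for A, with g C Z F f cancelling between [pir_C] and [rho2_C], and g F Z C f between [rho2_C]
    and [pil_C]. The traces of ZC and CZ are identified by cyclicity. *)
Lemma rhoM_C_mul3 C :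
  rhoM_C cst pd Z C ((g *m F *m f) 0 0) =
    (pir_C cst pd Z C g *m F *m f + g *m rho2_C cst pd Z C F *m f
     + g *m F *m pil_C cst pd Z C f) 0 0.
Proof.
rewrite /rhoM_C /pir_C /rho2_C /pil_C TrD_mul3 mxtraceZ [\tr (Z *m _)]mxtrace_mulC.
rewrite !(mulmxDl, mulmxDr, mulNmx, mulmxN) -!(scalemxAl, scalemxAr) !mulmxA.
rewrite !(mxDE, mxNE, mxZE); ring.
Qed.

Lemma rhoM_mul3 A B C :
  rhoM_A cst pd Z A ((g *m F *m f) 0 0) + rhoM_B cst pd B ((g *m F *m f) 0 0)
  + rhoM_C cst pd Z C ((g *m F *m f) 0 0) =
    ((pir_A cst pd Z A g + pir_B cst pd B g + pir_C cst pd Z C g)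
       *m F *m f) 0 0
    + (g *m (rho2_A cst pd Z A F + rho2_B cst pd B F + rho2_C cst pd Z C F)
       *m f) 0 0
    + (g *m F *m (pil_A cst pd Z A f + pil_B cst pd B f + pil_C cst pd Z C f))
       0 0.
Proof.
rewrite rhoM_A_mul3 rhoM_B_mul3 rhoM_C_mul3 !(mulmxDl, mulmxDr) !mxDE; ring.
Qed.

End Derivations.

Section Morphisms.
Variables (R : rcfType) (Q Q' : comNzRingType) (phi : {rmorphism Q -> Q'}).
Variables (cst : R[i] -> Q) (pd : 'I_3 -> Q -> Q).
Variables (cst' : R[i] -> Q') (pd' : 'I_3 -> Q' -> Q').
Hypothesis cst_phi : forall c, cst' c = phi (cst c).
Hypothesis pd_phi : forall i x, pd' i (phi x) = phi (pd i x).
Variable Z : 'M[Q]_2.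
Local Notation e := (map_mx phi).

Lemma map_cst (A : 'M[R[i]]_2) : map_mx cst' A = e (map_mx cst A).
Proof. by apply/matrixP => i j; rewrite !mxE. Qed.

(** The actions on f and g are defined over P, whereas the product rule is applied over P[sqrt N]. A
    ring morphism compatible with constants and partial derivatives carries one to the other. *)
Lemma TrDmx_map m n (T : 'M[Q]_2) (G : 'M[Q]_(m, n)) :
  TrDmx cst' pd' (e T) (e G) = e (TrDmx cst pd T G).
Proof.
apply/matrixP => i j; rewrite !mxE /TrD rmorph_sum; apply: eq_bigr => k _.
rewrite rmorph_sum; apply: eq_bigr => l _; rewrite rmorphM mxE /dZ.
by congr (_ * _); do 2?case: ifP => _; rewrite pd_phi // cst_phi rmorphM.
Qed.

Lemma pil_A_map A f : pil_A cst' pd' (e Z) A (e f) = e (pil_A cst pd Z A f).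
Proof.
rewrite /pil_A map_cst (map_trmx phi) -!map_mxM -map_mxD trace_map_mx.
by rewrite TrDmx_map -map_mxZ -map_mxD -map_mxN -map_mxD.
Qed.

Lemma pil_B_map B f : pil_B cst' pd' B (e f) = e (pil_B cst pd B f).
Proof. by rewrite /pil_B map_cst TrDmx_map -map_mxN. Qed.

Lemma pil_C_map C f : pil_C cst' pd' (e Z) C (e f) = e (pil_C cst pd Z C f).
Proof.
rewrite /pil_C map_cst -!map_mxM trace_map_mx TrDmx_map.
by rewrite -map_mxZ -map_mxD -map_mxB.
Qed.

Lemma pir_A_map A g : pir_A cst' pd' (e Z) A (e g) = e (pir_A cst pd Z A g).
Proof.
rewrite /pir_A map_cst (map_trmx phi) -!map_mxM -map_mxD trace_map_mx.
by rewrite TrDmx_map -map_mxZ -map_mxD -map_mxN -map_mxD.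
Qed.

Lemma pir_B_map B g : pir_B cst' pd' B (e g) = e (pir_B cst pd B g).
Proof. by rewrite /pir_B map_cst TrDmx_map -map_mxN. Qed.

Lemma pir_C_map C g : pir_C cst' pd' (e Z) C (e g) = e (pir_C cst pd Z C g).
Proof.
rewrite /pir_C map_cst -!map_mxM trace_map_mx TrDmx_map.
by rewrite -map_mxZ -map_mxD -map_mxB.
Qed.

Lemma pil_map A B C f :
  e (pil_A cst pd Z A f + pil_B cst pd B f + pil_C cst pd Z C f) =
    pil_A cst' pd' (e Z) A (e f) + pil_B cst' pd' B (e f)
    + pil_C cst' pd' (e Z) C (e f).
Proof. by rewrite 2!map_mxD pil_A_map pil_B_map pil_C_map. Qed.

Lemma pir_map A B C g :
  e (pir_A cst pd Z A g + pir_B cst pd B g + pir_C cst pd Z C g) =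
    pir_A cst' pd' (e Z) A (e g) + pir_B cst' pd' B (e g)
    + pir_C cst' pd' (e Z) C (e g).
Proof. by rewrite 2!map_mxD pir_A_map pir_B_map pir_C_map. Qed.

End Morphisms.

Theorem proposition110 (R : realType) (X : sp4 R[i])
    (g : modU' R) (F : modW R) (f : modU R) :
  rhoM X (mul3 g F f) =
    mul3 (pir X g) F f + mul3 g (rho2 X F) f + mul3 g F (pil X f).
Proof.
have cE c : cstS c = @embP R (cstP c) by [].
(* Elements of N^(1/2) P are compared in P[sqrt N]. *)
apply: val_inj => /=.
(* The embedding moves inside both actions because [pdS] extends [pdP]. As [ZS] is by definition the
   image of [ZP], all terms now live over P[sqrt N]. *)
rewrite [map_mx _ (pil _ _)](pil_map _ _ _ (@embP R) _ _ _ _ cE (@pdS_embP R)).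
rewrite [map_mx _ (pir _ _)](pir_map _ _ _ (@embP R) _ _ _ _ cE (@pdS_embP R)).
exact: (rhoM_mul3 _ _ _ _ _ (@pdSD R) (@pdS_leibniz R)).
Qed.
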